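(* Let $f:\mathbb{R}^n\to\mathbb{R}$ be differentiable with Lipschitz continuous gradient $\nabla f:\mathbb{R}^n\to\mathbb{R}^n$ with Lipschitz constant $L>0$ (A1), and suppose there exists $f_{low}\in\mathbb{R}$ with $f(x)\ge f_{low}$ for all $x\in\mathbb{R}^n$ (A2). Let $\{x_k\}_{k\ge0}$ be generated by Algorithm 1 (described in the context) with $x_0\in\mathbb{R}^n$, $\alpha_0,\sigma,\theta>0$, $\beta,\rho\in(0,1)$, $M\in\mathbb{N}\setminus\{0\}$, and suppose there exist constants $c_1,c_2>0$ such that the search directions satisfy $$\langle\nabla f(x_k),d_k\rangle\le -c_1\|\nabla f(x_k)\|^2\quad\text{and}\quad \|d_k\|\le c_2\|\nabla f(x_k)\|\quad\text{for all }k\ge 0\qquad\text{(A3)}.$$ Given $\epsilon>0$, let $T(\epsilon)=\inf\{k\in\mathbb{N}:\|\nabla f(x_k)\|\le\epsilon\}$. Then $$T(\epsilon)\le\begin{cases}\left[\tilde L(f(x_0)-f_{low})+\dfrac{\tilde L\sigma\theta}{(\theta-1)}\right]\epsilon^{-2}, & \text{if }\theta>1,\\[3mm] \max\left\{2\tilde L(f(x_0)-f_{low})\epsilon^{-2},\ \left[\dfrac{2\tilde L\sigma}{(1-\theta)}\right]^{\frac1\theta}\epsilon^{-\frac2\theta}\right\}, & \text{if }\theta\in(0,1),\end{cases}$$ where $$\tilde L=\max\left\{\frac{1}{\rho\beta\alpha_0c_1},\ \frac{L}{2\rho(1-\rho)\beta}\left(\frac{c_2}{c_1}\right)^2\ri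ght\}.$$
   Context: Here $\langle\cdot,\cdot\rangle$ is the Euclidean inner product on $\mathbb{R}^n$ and $\|\cdot\|$ the Euclidean norm; $\mathbb{N}$ includes $0$, and $\inf\emptyset=+\infty$. Algorithm 1 (non-monotone line-search with modified Metropolis-based relaxation term). Step 0. Given $x_0\in\mathbb{R}^n$, $\alpha_0,\sigma,\theta>0$, $\beta,\rho\in(0,1)$ and $M\in\mathbb{N}\setminus\{0\}$, set $m(0)=0$ and $k:=0$. Step 1. Compute a search direction $d_k\in\mathbb{R}^n$ with $\langle\nabla f(x_k),d_k\rangle<0$, and set $i:=0$. Step 2.1. Compute $x_{k,i}^+=x_k+\beta^i\alpha_kd_k$ and $$\nu_{k,i}=\sigma\cdot\exp\left(-\max\left\{\theta,\ \frac{f_{l(k)}-f(x_{k,i}^+)}{\rho\beta^i\alpha_k\langle\nabla f(x_k),d_k\rangle}\right\}\ln(k+1)\right),$$ where $f_{l(k)}=\max_{0\le j\le m(k)}f(x_{k-j})$. Step 2.2. If $$f(x_{k,i}^+)\le f(x_k)+\rho\beta^i\alpha_k\langle\nabla f(x_k),d_k\rangle+\nu_{k,i},$$ set $i_k=i$, $\nu_k=\nu_{k,i_k}$ and go to Step 3. Otherwise set $i:=i+1$ and go back to Step 2.1. Step 3. Define $x_{k+1}=x_{k,i_k}^+$, $\alpha_{k+1}=\beta^{i_k-1}\alpha_k$, $m(k+1)=\min\{m(k)+1,M\}$, set $k:=k+1$ and go to Step 1. A sequence $\{x_k\}_{k\ge0}$ generated by Algorithm 1 is an infinite sequence of iterates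 obtained by executing these steps for $k=0,1,2,\ldots$; in particular, by Step 1, $\langle\nabla f(x_k),d_k\rangle<0$ for every $k$. *)

(* Defs.v *)
From HB Require Import structures.
From mathcomp Require Import all_boot all_order all_algebra.
From mathcomp Require Import all_classical all_reals all_analysis.

Set Implicit Arguments.
Unset Strict Implicit.
Unset Printing Implicit Defensive.

Import Order.TTheory GRing.Theory Num.Theory.
Import numFieldNormedType.Exports.

Local Open Scope classical_set_scope.
Local Open Scope ring_scope.

Definition inner (R : realType) (n : nat) (u v : 'rV[R]_n) : R :=
  \sum_(i < n) u 0 i * v 0 i.

(* The norm `|u| carried by 'rV[R]_n in the library is the sup norm. *)
Definition norm2 (R : realType) (n : nat) (u : 'rV[R]_n) : R :=
  Num.sqrt (inner u u).

(* Total function; it is the gradient of f at x when f is differentiable at x. *)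
Definition grad (R : realType) (n : nat) (f : 'rV[R]_n -> R) (x : 'rV[R]_n) :
    'rV[R]_n :=
  \row_(i < n) 'D_(delta_mx 0 i) f x.

Section Algorithm.
Context (R : realType) (n : nat).
Implicit Types (f : 'rV[R]_n -> R) (x d : nat -> 'rV[R]_n).
Implicit Types (alpha : nat -> R) (m : nat -> nat).

(* f_{l(k)}; the default value f (x k) of the big maximum is its term j = 0. *)
Definition fmax f x m (k : nat) : R :=
  \big[Num.max/f (x k)]_(0 <= j < (m k).+1) f (x (k - j)%N).

Definition trial (beta : R) x alpha d (k i : nat) : 'rV[R]_n :=
  x k + (beta ^+ i * alpha k) *: d k.

(* rho beta^i alpha_k <grad f (x_k), d_k> *)
Definition slope f (beta rho : R) x alpha d (k i : nat) : R :=
  rho * beta ^+ i * alpha k * inner (grad f (x k)) (d k).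

Definition nu f (sigma theta beta rho : R) x alpha d m (k i : nat) : R :=
  sigma * expR (- (Num.max theta
                     ((fmax f x m k - f (trial beta x alpha d k i))
                        / slope f beta rho x alpha d k i)
                   * ln (k.+1%:R))).

Definition accepted f (sigma theta beta rho : R) x alpha d m (k i : nat) :
    Prop :=
  f (trial beta x alpha d k i) <=
    f (x k) + slope f beta rho x alpha d k i
    + nu f sigma theta beta rho x alpha d m k i.

(* The sequences x, alpha, d, m, i are those of an infinite execution of the
   line-search; i k is the number of backtracking steps at iteration k. In
   alpha_step the exponent is an integer, equal to -1 when i k = 0. *)
Record algorithm1 f (x0 : 'rV[R]_n) (alpha0 sigma theta beta rho : R)
    (M : nat) x alpha d m (i : nat -> nat) : Prop := Algorithm1 {
  x_init : x 0%N = x0 ;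
  alpha_init : alpha 0%N = alpha0 ;
  m_init : m 0%N = 0%N ;
  descent : forall k, inner (grad f (x k)) (d k) < 0 ;
  i_accepted : forall k, accepted f sigma theta beta rho x alpha d m k (i k) ;
  i_first : forall k j, (j < i k)%N ->
    ~ accepted f sigma theta beta rho x alpha d m k j ;
  x_step : forall k, x k.+1 = trial beta x alpha d k (i k) ;
  alpha_step : forall k, alpha k.+1 = beta ^ ((i k)%:Z - 1) * alpha k ;
  m_step : forall k, m k.+1 = minn (m k).+1 M
}.

(* T(eps), in the extended reals; it is +oo when no iterate qualifies. *)
Definition hitting_time f x (eps : R) : \bar R :=
  ereal_inf [set (k%:R : R)%:E | k in [set k : nat | norm2 (grad f (x k)) <= eps]].

End Algorithm.

Definition Ltilde (R : realType) (L c1 c2 alpha0 beta rho : R) : R :=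
  Num.max (1 / (rho * beta * alpha0 * c1))
          (L / (2 * rho * (1 - rho) * beta) * (c2 / c1) ^+ 2).

(* Main.v *)
Require Import Defs.
From HB Require Import structures.
From mathcomp Require Import all_boot all_order all_algebra.
From mathcomp Require Import all_classical all_reals all_analysis.
From mathcomp Require Import ring lra.

Import Order.TTheory GRing.Theory Num.Theory.
Import numFieldNormedType.Exports.

Local Open Scope classical_set_scope.
Local Open Scope ring_scope.

Set Implicit Arguments.
Unset Strict Implicit.
Unset Printing Implicit Defensive.

(** Each iteration lowers [f] by at least [norm2 (grad f (x k)) ^+ 2 / Lt], up
    to an error [nu] that is at most [sigma * k.+1%:R `^ (- theta)]. The bound
    on [nu] holds because the maximum in its exponent is at least [theta]
    ([nu_le]).

    The gain comes from a lower bound on the step sizes. For a function with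
    [L]-Lipschitz gradient, the quadratic upper bound
    ([lipschitz_grad_upper_bound]) shows that every step of length at most
    [2 (1 - rho) c1 / (L c2 ^ 2)] satisfies the Armijo condition even without
    the relaxation term ([armijo_small_step]). So backtracking never rejects
    such a step. As [alpha k.+1] is either the last rejected step or larger
    than [alpha k], it never falls below the minimum of [alpha0] and that
    threshold ([algorithm1_step_size_ge]); the step actually taken is
    [beta * alpha k.+1]. The constant [Lt] is exactly what turns the resulting
    decrease into a multiple of the squared gradient norm ([Ltilde_min_step]).

    Summing over the [T] iterations that precede the first gradient of norm at
    most [eps] telescopes to
      [T * eps ^ 2 <= Lt * (f x0 - flow + sigma * \sum_(j < T) (j+1) ^ (-theta))]
    ([algorithm1_budget]). If [theta > 1] the sum is bounded by
    [theta / (theta - 1)], and the claim follows at once. If [theta < 1] it is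
    at most [T ^ (1 - theta) / (1 - theta)], and either
    the part coming from [f x0 - flow] or the part coming from the sum accounts
    for at least half of the left-hand side; solving for [T] in
    each case gives the two members of the maximum ([le_max_of_sum_bound]). *)

(** * Euclidean inner product and directional derivatives *)

Lemma inner_ge0 (R : realType) (n : nat) (u : 'rV[R]_n) : 0 <= inner u u.
Proof. by apply: sumr_ge0 => i _; rewrite -expr2 sqr_ge0. Qed.

Lemma norm2_ge0 (R : realType) (n : nat) (u : 'rV[R]_n) : 0 <= norm2 u.
Proof. exact: sqrtr_ge0. Qed.

Lemma sqr_norm2 (R : realType) (n : nat) (u : 'rV[R]_n) :
  norm2 u ^+ 2 = inner u u.
Proof. by rewrite sqr_sqrtr // inner_ge0. Qed.

Lemma innerBl (R : realType) (n : nat) (u v w : 'rV[R]_n) :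
  inner (u - v) w = inner u w - inner v w.
Proof.
by rewrite /inner -sumrB; apply: eq_bigr => i _; rewrite !mxE mulrBl.
Qed.

Lemma norm2Z (R : realType) (n : nat) (t : R) (u : 'rV[R]_n) :
  0 <= t -> norm2 (t *: u) = t * norm2 u.
Proof.
move=> t0; rewrite /norm2; have -> : inner (t *: u) (t *: u) = t ^+ 2 * inner u u.
  by rewrite /inner mulr_sumr; apply: eq_bigr => i _; rewrite !mxE; ring.
by rewrite sqrtrM ?sqr_ge0 // sqrtr_sqr ger0_norm.
Qed.

(** A form of the Cauchy-Schwarz inequality that needs no case distinction on
    vanishing vectors: expanding [0 <= inner (u - c *: v) (u - c *: v)] bounds
    [2 * c * inner u v] by the sum of two terms, each at most
    [c ^+ 2 * norm2 v ^+ 2]. *)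
Lemma inner_le_norm2 (R : realType) (n : nat) (c : R) (u v : 'rV[R]_n) :
  0 < c -> norm2 u <= c * norm2 v -> inner u v <= c * norm2 v ^+ 2.
Proof.
move=> c0 uv.
have uv2 : inner u u <= c ^+ 2 * inner v v.
  rewrite -!sqr_norm2 -exprMn lerXn2r // nnegrE ?norm2_ge0 //.
  by rewrite mulr_ge0 ?norm2_ge0 // ltW.
have := inner_ge0 (u - c *: v).
have -> : inner (u - c *: v) (u - c *: v) =
    inner u u - 2 * c * inner u v + c ^+ 2 * inner v v.
  rewrite /inner !mulr_sumr -sumrB -big_split /=.
  by apply: eq_bigr => i _; rewrite !mxE; ring.
rewrite sqr_norm2 => uv0; rewrite -(ler_pM2l c0); nra.
Qed.

Lemma deriveE_grad (R : realType) (n : nat) (f : 'rV[R]_n -> R)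
    (y v : 'rV[R]_n) :
  differentiable f y -> 'D_v f y = inner (grad f y) v.
Proof.
move=> fy; rewrite deriveE // {1}(row_sum_delta v) linear_sum /=.
by apply: eq_bigr => i _; rewrite linearZ /= mxE deriveE // mulrC.
Qed.

Lemma is_derive_along_line (R : realType) (n : nat) (f : 'rV[R]_n -> R)
    (y v : 'rV[R]_n) (s : R) :
  differentiable f (y + s *: v) ->
  is_derive s 1 (fun t => f (y + t *: v)) (inner (grad f (y + s *: v)) v).
Proof.
move=> fys.
have eq_quot : (fun h : R => h^-1 *: (f (y + (h *: 1 + s) *: v)
                 - f (y + s *: v))) =
               (fun h => h^-1 *: (f (h *: v + (y + s *: v)) - f (y + s *: v))).
  by apply/funext => h; rewrite [h *: 1]mulr1 scalerDl addrCA.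
have := diff_derivable (v := v) fys.
have := deriveE_grad v fys.
rewrite /derive /derivable => dv der; split.
  by rewrite /derivable eq_quot.
by rewrite /derive eq_quot.
Qed.

(** * The Armijo condition for short steps *)

(** The difference between the two sides, as a function of the step [t],
    vanishes at [0], and its derivative is nonpositive because the gradient
    varies by at most [L * s * norm2 v] over a step [s]. *)
Lemma lipschitz_grad_upper_bound (R : realType) (n : nat)
    (f : 'rV[R]_n -> R) (L : R) (y v : 'rV[R]_n) (t : R) :
  (forall z, differentiable f z) -> 0 < L ->
  (forall z w, norm2 (grad f z - grad f w) <= L * norm2 (z - w)) ->
  0 <= t ->
  f (y + t *: v) <=
    f y + t * inner (grad f y) v + L / 2 * t ^+ 2 * norm2 v ^+ 2.
Proof.
move=> fd L0 glip t0; set a := inner _ _; set b := norm2 v ^+ 2.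
pose phi (s : R) := f (y + s *: v) - (a * s + L / 2 * b * s ^+ 2).
pose dphi (s : R) := inner (grad f (y + s *: v)) v - (a + L * b * s).
have phi' (s : R) : is_derive s 1 phi (dphi s).
  have dF := is_derive_along_line (fd (y + s *: v)).
  have -> : phi = (fun t => f (y + t *: v)) -
      (a \*: id + (L / 2 * b) \*: (id ^+ 2)) by [].
  apply: is_derive_eq.
  by rewrite /dphi /GRing.scale /=; field.
have phic : {within `[0, t], continuous phi}.
  by apply: derivable_within_continuous => s _; have [] := phi' s.
have [c] := MVT_segment t0 (fun s _ => phi' s) phic.
rewrite in_itv /= => /andP[c0 ct].
suff dphic : dphi c <= 0.
  rewrite /phi scale0r addr0 mulr0 expr0n /= mulr0 addr0 !subr0 => phiE.
  have : dphi c * t <= 0 by rewrite mulr_le0_ge0.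
  rewrite -phiE; lra.
(* The comparison of inner products needs a positive factor, so c = 0, where
   the derivative vanishes, is treated apart. *)
rewrite /dphi; move: c0; rewrite le_eqVlt => /orP[/eqP <-|c0].
  by rewrite scale0r addr0 mulr0 addr0 subrr.
suff : inner (grad f (y + c *: v) - grad f y) v <= L * c * b.
  by rewrite innerBl -/a; lra.
apply: inner_le_norm2; first exact: mulr_gt0.
by apply: le_trans (glip _ _) _; rewrite addrC addKr norm2Z ?mulrA // ltW.
Qed.

(** The quadratic error term [L / 2 * t ^ 2 * norm2 v ^ 2] is at most
    [(1 - rho) * t] times the modulus of the slope, since the angle and length
    conditions bound [norm2 v ^ 2] by a multiple of that modulus. *)
Lemma armijo_small_step (R : realType) (n : nat) (f : 'rV[R]_n -> R)
    (L c1 c2 rho t : R) (y v : 'rV[R]_n) :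
  (forall z, differentiable f z) -> 0 < L ->
  (forall z w, norm2 (grad f z - grad f w) <= L * norm2 (z - w)) ->
  0 < c1 -> 0 < c2 -> rho < 1 ->
  inner (grad f y) v <= - c1 * norm2 (grad f y) ^+ 2 ->
  norm2 v <= c2 * norm2 (grad f y) ->
  0 <= t <= 2 * (1 - rho) * c1 / (L * c2 ^+ 2) ->
  f (y + t *: v) <= f y + rho * t * inner (grad f y) v.
Proof.
move=> fd L0 glip c10 c20 rho1 angle vnorm /andP[t0 tmax].
have := lipschitz_grad_upper_bound y v fd L0 glip t0.
have := norm2_ge0 v; have := norm2_ge0 (grad f y).
move: angle vnorm; set g := norm2 _; set a := inner _ _; set b := norm2 v.
move=> angle vnorm g0 b0 up; apply: le_trans up _.
have b2 : b ^+ 2 <= c2 ^+ 2 * g ^+ 2.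
  by rewrite -exprMn lerXn2r // nnegrE mulr_ge0 // ltW.
have tL : t * (L * c2 ^+ 2) <= 2 * (1 - rho) * c1.
  by rewrite -ler_pdivlMr // mulr_gt0 // exprn_gt0.
have : L * t * b ^+ 2 <= 2 * (1 - rho) * - a.
  apply: (@le_trans _ _ (L * t * (c2 ^+ 2 * g ^+ 2))).
    by rewrite ler_wpM2l // mulr_ge0 // ltW.
  apply: (@le_trans _ _ (2 * (1 - rho) * c1 * g ^+ 2)).
    have := sqr_ge0 g; nra.
  rewrite -mulrA ler_wpM2l; nra.
move=> key; have : t * (L * t * b ^+ 2) <= t * (2 * (1 - rho) * - a).
  by rewrite ler_wpM2l.
lra.
Qed.

(** * Tangent lines of power functions and sums of negative powers *)

(** Bernoulli's inequality for exponents in [(0, 1)]. Writing [A] for the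
    tangent value, weighted arithmetic-geometric means of [u / A] and [1 / A],
    whose weighted arithmetic mean is [1], give [p * ln u <= ln A]; they reduce
    to [1 + y <= expR y] at two points. *)
Lemma powR_le_tangent (R : realType) (p u : R) :
  0 < p < 1 -> 0 <= u -> u `^ p <= 1 + p * (u - 1).
Proof.
move=> /andP[p0 p1]; rewrite le_eqVlt => /orP[/eqP <-|u0].
  by rewrite powR0 ?gt_eqF //; lra.
set A := 1 + _; have A0 : 0 < A by rewrite /A; nra.
rewrite -[leRHS]lnK ?posrE // /powR gt_eqF // ler_expR.
have e1 : 1 + (ln u - ln A) <= u / A.
  by rewrite -ln_div ?posrE // -[leRHS]lnK ?posrE ?divr_gt0 // expR_ge1Dx.
have e2 : 1 - ln A <= A^-1.
  by rewrite -[leRHS]lnK ?posrE ?invr_gt0 // lnV ?posrE // expR_ge1Dx.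
have : (1 - p) * (1 - ln A) + p * (1 + (ln u - ln A)) <=
       (1 - p) * A^-1 + p * (u / A).
  by apply: lerD; rewrite ler_wpM2l // ?subr_ge0 ltW.
have -> : (1 - p) * A^-1 + p * (u / A) = 1.
  by rewrite mulrA -mulrDl (_ : _ + _ = A) ?divff ?gt_eqF // /A; ring.
lra.
Qed.

Lemma powR_ge_tangent (R : realType) (p u : R) :
  p < 0 -> 0 < u -> 1 + p * (u - 1) <= u `^ p.
Proof.
move=> p0 u0; rewrite /powR gt_eqF //; apply: le_trans (expR_ge1Dx _).
rewrite lerD2l ler_nM2l //.
by rewrite lerBrDl -[leRHS]lnK ?posrE // expR_ge1Dx.
Qed.

Lemma powR_rescale (R : realType) (p x y : R) :
  0 < x -> 0 <= y -> y `^ p = (y / x) `^ p * x `^ p.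
Proof.
move=> x0 y0; have x0W := ltW x0.
by rewrite -powRM ?divr_ge0 // divfK // gt_eqF.
Qed.

(** The tangent inequality at [1], evaluated at [y / x] and scaled by
    [x `^ p], becomes the tangent inequality at [x]. *)
Lemma powR_tangentE (R : realType) (p x y : R) : 0 < x ->
  (1 + p * (y / x - 1)) * x `^ p = x `^ p - p * x `^ (p - 1) * (x - y).
Proof.
move=> x0; have xN0 : x != 0 by rewrite gt_eqF.
by rewrite powRB ?xN0 ?implybT // powRr1 ?(ltW x0) //; field.
Qed.

(** The tangent to [y |-> y `^ (1 - theta)] at [T.+1], evaluated at [T], bounds
    each summand by a telescoping difference, in place of a comparison with an
    integral. *)
Lemma sum_powRN_lt1 (R : realType) (theta : R) (T : nat) : 0 < theta < 1 ->
  \sum_(0 <= j < T) (j.+1%:R : R) `^ (- theta) <=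
    T%:R `^ (1 - theta) / (1 - theta).
Proof.
move=> /andP[th0 th1]; elim: T => [|T IH].
  by rewrite big_geq // powR0 ?mul0r // subr_eq0 gt_eqF.
rewrite big_nat_recr //=; apply: le_trans (lerD IH (lexx _)) _.
rewrite -lerBrDl -mulrBl ler_pdivlMr ?subr_gt0 //.
have T0 : 0 < T.+1%:R :> R by rewrite ltr0n.
rewrite (powR_rescale (1 - theta) T0 (ler0n R T)).
have := powR_le_tangent (p := 1 - theta) (u := T%:R / T.+1%:R).
rewrite divr_ge0 ?ler0n // => /(_ _ isT) tan.
have {}tan := ler_wpM2r (powR_ge0 T.+1%:R (1 - theta)) (tan ltac:(lra)).
rewrite powR_tangentE // (_ : 1 - theta - 1 = - theta) in tan; last by ring.
rewrite -[X in X - T%:R]natr1 in tan; nra.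
Qed.

(** As for [theta < 1], but [y `^ (1 - theta)] is now unbounded near [0],
    so the first summand is kept out of the telescoping. *)
Lemma sum_powRN_gt1 (R : realType) (theta : R) (T : nat) : 1 < theta ->
  \sum_(0 <= j < T) (j.+1%:R : R) `^ (- theta) <= theta / (theta - 1).
Proof.
move=> th1; have th10 : 0 < theta - 1 by rewrite subr_gt0.
case: T => [|T]; first by rewrite big_geq // divr_ge0 // ltW //; lra.
(* The term - T.+1 ^ (1 - theta) is what remains of the telescoping sum; it
   makes the induction go through. *)
suff : \sum_(0 <= j < T.+1) (j.+1%:R : R) `^ (- theta) <=
    (theta - T.+1%:R `^ (1 - theta)) / (theta - 1).
  move=> /le_trans; apply; rewrite ler_pM2r ?invr_gt0 //.
  by have := powR_ge0 T.+1%:R (1 - theta); lra.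
elim: T => [|T IH]; first by rewrite big_nat1 !powR1 divff // gt_eqF.
rewrite big_nat_recr //=; apply: le_trans (lerD IH (lexx _)) _.
rewrite -lerBrDl -mulrBl ler_pdivlMr //.
have T1 : 0 < T.+1%:R :> R by rewrite ltr0n.
have T2 : 0 < T.+2%:R :> R by rewrite ltr0n.
rewrite (powR_rescale (1 - theta) T2 (ltW T1)).
have := powR_ge_tangent (p := 1 - theta) (u := T.+1%:R / T.+2%:R).
move=> /(_ ltac:(lra) (divr_gt0 T1 T2)) tan.
have {}tan := ler_wpM2r (powR_ge0 T.+2%:R (1 - theta)) tan.
rewrite powR_tangentE // (_ : 1 - theta - 1 = - theta) in tan; last by ring.
rewrite -[X in X - T.+1%:R]natr1 in tan; nra.
Qed.

(** * Hitting times *)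

(** A uniform bound on the lengths of initial runs of large gradients also
    rules out an infinite hitting time, since those lengths would then be
    unbounded. *)
Lemma hitting_time_le (R : realType) (n : nat) (f : 'rV[R]_n -> R)
    (x : nat -> 'rV[R]_n) (eps B : R) :
  (forall T : nat, (forall k, (k < T)%N -> eps < norm2 (grad f (x k))) ->
     T%:R <= B) ->
  (hitting_time f x eps <= B%:E)%E.
Proof.
move=> bound.
have [hit|nohit] := pselect (exists k, norm2 (grad f (x k)) <= eps).
  case: (ex_minnP hit) => T gT Tmin.
  apply: ge_ereal_inf; exists T%:R%:E; first by exists T.
  rewrite lee_fin; apply: bound => k kT; rewrite ltNge; apply/negP => gk.
  by have := Tmin k gk; rewrite leqNgt kT.
have := bound (Num.bound `|B|).+1 => /(_ _)/wrap[].
  by move=> k _; rewrite ltNge; apply/negP => gk; apply: nohit; exists k.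
move=> boundB; exfalso.
have := archi_boundP (normr_ge0 B); have := ler_norm B.
by move: boundB; rewrite -natr1; lra.
Qed.

(** * Step sizes and decrease along a run *)

(** The value below which no step size falls: the second argument is the
    threshold under which the Armijo condition is automatic. *)
Definition min_step (R : realType) (L c1 c2 alpha0 rho : R) : R :=
  Num.min alpha0 (2 * (1 - rho) * c1 / (L * c2 ^+ 2)).

Lemma min_step_gt0 (R : realType) (L c1 c2 alpha0 rho : R) :
  0 < L -> 0 < c1 -> 0 < c2 -> 0 < alpha0 -> rho < 1 ->
  0 < min_step L c1 c2 alpha0 rho.
Proof.
move=> L0 c10 c20 a0 rho1; rewrite lt_min a0 divr_gt0 //.
  by rewrite !mulr_gt0 // subr_gt0.
by rewrite mulr_gt0 // exprn_gt0.
Qed.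

Lemma Ltilde_gt0 (R : realType) (L c1 c2 alpha0 beta rho : R) :
  0 < c1 -> 0 < alpha0 -> 0 < beta -> 0 < rho ->
  0 < Ltilde L c1 c2 alpha0 beta rho.
Proof. by move=> c10 a0 b0 r0; rewrite lt_max divr_gt0 // !mulr_gt0. Qed.

(** At [t = min_step] the factor in parentheses is the inverse of one of the two
    arguments of the maximum defining [Ltilde]; it increases with [t]. *)
Lemma Ltilde_min_step (R : realType) (L c1 c2 alpha0 beta rho t : R) :
  0 < L -> 0 < c1 -> 0 < c2 -> 0 < alpha0 -> 0 < beta -> 0 < rho < 1 ->
  min_step L c1 c2 alpha0 rho <= t ->
  1 <= Ltilde L c1 c2 alpha0 beta rho * (rho * (beta * t) * c1).
Proof.
move=> L0 c10 c20 a0 b0 /andP[r0 r1] min_t.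
have scaled s : 0 < s -> s <= t -> (rho * (beta * s) * c1)^-1 <=
    Ltilde L c1 c2 alpha0 beta rho ->
    1 <= Ltilde L c1 c2 alpha0 beta rho * (rho * (beta * t) * c1).
  move=> s0 st inv_s; have pos : 0 < rho * (beta * s) * c1.
    by rewrite !mulr_gt0.
  rewrite -(mulVf (lt0r_neq0 pos)); apply: ler_pM => //.
  - by rewrite invr_ge0 ltW.
  - exact: ltW.
  - by rewrite ler_pM2r // ler_pM2l // ler_pM2l.
have m0 := min_step_gt0 L0 c10 c20 a0 r1.
apply: (scaled _ m0 min_t); rewrite /min_step minEle le_max.
case: ifP => _; apply/orP; [left|right].
  by rewrite div1r mulrA.
rewrite le_eqVlt; apply/orP; left; apply/eqP; field.
by rewrite !gt_eqF // subr_gt0.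
Qed.

(** If iteration [k] accepts its first trial, the next step size grows.
    Otherwise the next step size is the last rejected step, which must exceed
    the threshold of [armijo_small_step]. *)
Lemma algorithm1_step_size_ge (R : realType) (n : nat) (f : 'rV[R]_n -> R)
    (L : R) (x0 : 'rV[R]_n) (alpha0 sigma theta beta rho : R) (M : nat)
    (x : nat -> 'rV[R]_n) (alpha : nat -> R) (d : nat -> 'rV[R]_n)
    (m i : nat -> nat) (c1 c2 : R) :
  (forall y, differentiable f y) -> 0 < L ->
  (forall y z, norm2 (grad f y - grad f z) <= L * norm2 (y - z)) ->
  0 < alpha0 -> 0 < sigma -> 0 < beta < 1 -> 0 < rho < 1 ->
  algorithm1 f x0 alpha0 sigma theta beta rho M x alpha d m i ->
  0 < c1 -> 0 < c2 ->
  (forall k, inner (grad f (x k)) (d k) <= - c1 * norm2 (grad f (x k)) ^+ 2) ->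
  (forall k, norm2 (d k) <= c2 * norm2 (grad f (x k))) ->
  forall k, min_step L c1 c2 alpha0 rho <= alpha k.
Proof.
move=> fd L0 glip a0 s0 /andP[b0 b1] /andP[r0 r1] run c10 c20 angle dnorm.
have m0 := min_step_gt0 L0 c10 c20 a0 r1.
elim=> [|k IH]; first by rewrite (alpha_init run) ge_min lexx.
have ak0 : 0 < alpha k := lt_le_trans m0 IH.
rewrite (alpha_step run); case ik: (i k) => [|j].
  have b1W := ltW b1.
  by rewrite sub0r exprN1 (le_trans IH) // ler_peMl ?(ltW ak0) // invf_ge1.
rewrite (_ : j.+1%:Z - 1 = j%:Z); last by rewrite -natz -natr1 natz addrK.
rewrite leNgt; apply/negP => small.
have /(i_first run) : (j < i k)%N by rewrite ik.
apply; rewrite /accepted /slope /trial.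
have nu0 : 0 <= nu f sigma theta beta rho x alpha d m k j.
  by rewrite mulr_ge0 ?expR_ge0 // ltW.
rewrite -[leLHS]addr0 lerD // -(mulrA rho).
apply: (armijo_small_step fd L0 glip c10 c20 r1 (angle k) (dnorm k)).
rewrite mulr_ge0 ?exprn_ge0 ?ltW //=.
by apply: lt_le_trans small _; rewrite ge_min lexx orbT.
Qed.

Lemma nu_le (R : realType) (n : nat) (f : 'rV[R]_n -> R)
    (sigma theta beta rho : R) (x : nat -> 'rV[R]_n) (alpha : nat -> R)
    (d : nat -> 'rV[R]_n) (m : nat -> nat) (k i : nat) :
  0 <= sigma ->
  nu f sigma theta beta rho x alpha d m k i <= sigma * k.+1%:R `^ (- theta).
Proof.
move=> s0; rewrite ler_wpM2l // /powR pnatr_eq0 /= ler_expR mulNr lerN2.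
by rewrite ler_wpM2r ?le_max ?lexx // ln_ge0 // ler1n.
Qed.

(** The step taken is [beta * alpha k.+1], so the lower bound on step sizes at
    index [k.+1] gives a decrease proportional to the squared gradient norm. *)
Lemma algorithm1_sqr_grad_le (R : realType) (n : nat) (f : 'rV[R]_n -> R)
    (L : R) (x0 : 'rV[R]_n) (alpha0 sigma theta beta rho : R) (M : nat)
    (x : nat -> 'rV[R]_n) (alpha : nat -> R) (d : nat -> 'rV[R]_n)
    (m i : nat -> nat) (c1 c2 : R) :
  (forall y, differentiable f y) -> 0 < L ->
  (forall y z, norm2 (grad f y - grad f z) <= L * norm2 (y - z)) ->
  0 < alpha0 -> 0 < sigma -> 0 < beta < 1 -> 0 < rho < 1 ->
  algorithm1 f x0 alpha0 sigma theta beta rho M x alpha d m i ->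
  0 < c1 -> 0 < c2 ->
  (forall k, inner (grad f (x k)) (d k) <= - c1 * norm2 (grad f (x k)) ^+ 2) ->
  (forall k, norm2 (d k) <= c2 * norm2 (grad f (x k))) ->
  forall k, norm2 (grad f (x k)) ^+ 2 <=
    Ltilde L c1 c2 alpha0 beta rho *
      (f (x k) - f (x k.+1) + sigma * k.+1%:R `^ (- theta)).
Proof.
move=> fd L0 glip a0 s0 bitv ritv run c10 c20 angle dnorm k.
have step_ge := algorithm1_step_size_ge fd L0 glip a0 s0 bitv ritv run
  c10 c20 angle dnorm k.+1.
have /andP[b0 _] := bitv; have /andP[r0 r1] := ritv.
have Lt0 := Ltilde_gt0 L c2 c10 a0 b0 r0.
have t0 := lt_le_trans (min_step_gt0 L0 c10 c20 a0 r1) step_ge.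
have stepE : beta ^+ i k * alpha k = beta * alpha k.+1.
  rewrite (alpha_step run) mulrA; congr (_ * _).
  by rewrite -[X in X * _]expr1z -expfzDr ?gt_eqF // addrC subrK.
have acc := i_accepted run k.
rewrite /accepted -(x_step run) /slope -(mulrA rho) stepE in acc.
have nuk := nu_le f theta beta rho x alpha d m k (i k) (ltW s0).
have unit := Ltilde_min_step L0 c10 c20 a0 b0 ritv step_ge.
set g := norm2 _ ^+ 2; have g0 : 0 <= g by rewrite sqr_ge0.
apply: (@le_trans _ _ (Ltilde L c1 c2 alpha0 beta rho *
    (rho * (beta * alpha k.+1) * c1) * g)); first by rewrite ler_peMl.
rewrite -[leLHS]mulrA ler_pM2l //.
have : rho * (beta * alpha k.+1) * inner (grad f (x k)) (d k) <=
       rho * (beta * alpha k.+1) * (- c1 * g).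
  by rewrite ler_wpM2l ?angle // !mulr_ge0 // ltW.
lra.
Qed.

Lemma algorithm1_budget (R : realType) (n : nat) (f : 'rV[R]_n -> R)
    (L flow : R) (x0 : 'rV[R]_n) (alpha0 sigma theta beta rho : R) (M : nat)
    (x : nat -> 'rV[R]_n) (alpha : nat -> R) (d : nat -> 'rV[R]_n)
    (m i : nat -> nat) (c1 c2 eps : R) :
  (forall y, differentiable f y) -> 0 < L ->
  (forall y z, norm2 (grad f y - grad f z) <= L * norm2 (y - z)) ->
  (forall y, flow <= f y) ->
  0 < alpha0 -> 0 < sigma -> 0 < beta < 1 -> 0 < rho < 1 ->
  algorithm1 f x0 alpha0 sigma theta beta rho M x alpha d m i ->
  0 < c1 -> 0 < c2 ->
  (forall k, inner (grad f (x k)) (d k) <= - c1 * norm2 (grad f (x k)) ^+ 2) ->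
  (forall k, norm2 (d k) <= c2 * norm2 (grad f (x k))) ->
  0 < eps ->
  forall T : nat, (forall k, (k < T)%N -> eps < norm2 (grad f (x k))) ->
  T%:R * eps ^+ 2 <= Ltilde L c1 c2 alpha0 beta rho *
    (f x0 - flow + sigma * \sum_(0 <= j < T) j.+1%:R `^ (- theta)).
Proof.
move=> fd L0 glip fl a0 s0 bitv ritv run c10 c20 angle dnorm e0 T bigT.
have /andP[b0 _] := bitv; have /andP[r0 _] := ritv.
have Lt0 := Ltilde_gt0 L c2 c10 a0 b0 r0.
have sqr_grad := algorithm1_sqr_grad_le fd L0 glip a0 s0 bitv ritv run
  c10 c20 angle dnorm.
suff : T%:R * eps ^+ 2 <= Ltilde L c1 c2 alpha0 beta rho *
    (f x0 - f (x T) + sigma * \sum_(0 <= j < T) j.+1%:R `^ (- theta)).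
  move=> /le_trans; apply; rewrite ler_pM2l // lerD2r lerD2l lerN2; exact: fl.
elim: T bigT => [|T IH] bigT.
  by rewrite (x_init run) big_geq // subrr !mulr0 addr0 mulr0 mul0r.
have {}IH := IH (fun k kT => bigT k (ltnW kT)).
have eT : eps ^+ 2 <= norm2 (grad f (x T)) ^+ 2.
  by rewrite lerXn2r ?nnegrE ?norm2_ge0 ?ltW // bigT.
have := lerD IH (le_trans eT (sqr_grad T)).
by rewrite big_nat_recr //= -natr1; lra.
Qed.

(** * Iteration complexity *)

(** One of the two terms on the right of the hypothesis is at least half of
    [T%:R * eps ^+ 2]. If it is the second, dividing by [T%:R `^ (1 - theta)]
    leaves a bound on [T%:R `^ theta]. *)
Lemma le_max_of_sum_bound (R : realType) (theta A B eps : R) (T : nat) :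
  0 < theta -> 0 <= A -> 0 <= B -> 0 < eps ->
  T%:R * eps ^+ 2 <= A + B * T%:R `^ (1 - theta) ->
  T%:R <= Num.max (2 * A * eps ^- 2)
            ((2 * B) `^ (1 / theta) * eps `^ (- (2 / theta))).
Proof.
move=> th0 A0 B0 e0 bound; rewrite le_max.
have e20 : 0 < eps ^+ 2 by rewrite exprn_gt0.
have [TA|AT] := lerP (T%:R * eps ^+ 2) (2 * A).
  by rewrite ler_pdivlMr // TA.
apply/orP; right.
have T0 : 0 < T%:R :> R by rewrite -(pmulr_lgt0 _ e20); lra.
have TN0 : T%:R != 0 :> R by rewrite gt_eqF.
have Tpow : T%:R `^ theta <= 2 * B * eps ^- 2.
  rewrite ler_pdivlMr // -(ler_pM2r (powR_gt0 (1 - theta) T0)) mulrAC.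
  by rewrite -powRD ?TN0 ?implybT // subrKC powRr1 ?(ltW T0) //; lra.
have -> : eps `^ (- (2 / theta)) = (eps ^- 2) `^ (1 / theta).
  by rewrite -powR_invn ?(ltW e0) // -powRrM mulNr mul1r.
rewrite -powRM ?invr_ge0 ?(ltW e20) ?mulr_ge0 //.
have -> : T%:R = (T%:R `^ theta) `^ (1 / theta) :> R.
  by rewrite -powRrM mul1r divff ?gt_eqF // powRr1 // ltW.
rewrite ge0_ler_powR ?nnegrE ?powR_ge0 ?divr_ge0 ?(ltW th0) ?(ltW e20) //.
by rewrite mulr_ge0.
Qed.

Theorem theorem2p2 (R : realType) (n : nat) (f : 'rV[R]_n -> R)
  (L flow : R)
  (x0 : 'rV[R]_n) (alpha0 sigma theta beta rho : R) (M : nat)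
  (x : nat -> 'rV[R]_n) (alpha : nat -> R) (d : nat -> 'rV[R]_n)
  (m i : nat -> nat) (c1 c2 eps : R)
  (f_diff : forall y, differentiable f y)
  (L_gt0 : 0 < L)
  (grad_lip : forall y z,
     norm2 (grad f y - grad f z) <= L * norm2 (y - z))
  (f_low : forall y, flow <= f y)
  (alpha0_gt0 : 0 < alpha0) (sigma_gt0 : 0 < sigma) (theta_gt0 : 0 < theta)
  (beta_itv : 0 < beta < 1) (rho_itv : 0 < rho < 1) (M_neq0 : M <> 0%N)
  (run : algorithm1 f x0 alpha0 sigma theta beta rho M x alpha d m i)
  (c1_gt0 : 0 < c1) (c2_gt0 : 0 < c2)
  (d_angle : forall k,
     inner (grad f (x k)) (d k) <= - c1 * norm2 (grad f (x k)) ^+ 2)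
  (d_norm : forall k, norm2 (d k) <= c2 * norm2 (grad f (x k)))
  (eps_gt0 : 0 < eps) :
  let Lt := Ltilde L c1 c2 alpha0 beta rho in
  (1 < theta ->
     (hitting_time f x eps <=
       ((Lt * (f x0 - flow) + Lt * sigma * theta / (theta - 1))
          * eps ^- 2)%:E)%E) /\
  (theta < 1 ->
     (hitting_time f x eps <=
       (Num.max (2 * Lt * (f x0 - flow) * eps ^- 2)
                ((2 * Lt * sigma / (1 - theta)) `^ (1 / theta)
                   * eps `^ (- (2 / theta))))%:E)%E).
Proof.
move=> Lt.
have /andP[b0 _] := beta_itv; have /andP[r0 _] := rho_itv.
have Lt0 : 0 < Lt := Ltilde_gt0 L c2 c1_gt0 alpha0_gt0 b0 r0.
have Ls0 : 0 < Lt * sigma by rewrite mulr_gt0.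
have budget := algorithm1_budget f_diff L_gt0 grad_lip f_low alpha0_gt0
  sigma_gt0 beta_itv rho_itv run c1_gt0 c2_gt0 d_angle d_norm eps_gt0.
split=> th1; apply: hitting_time_le => T /budget {}budget.
  rewrite ler_pdivlMr ?exprn_gt0 //; apply: le_trans budget _.
  rewrite mulrDr lerD2l mulrA -[leRHS]mulrA ler_pM2l //.
  exact: sum_powRN_gt1.
rewrite -(mulrA 2 Lt (_ - _)) -[2 * Lt * sigma / _]mulrA -(mulrA 2 Lt).
apply: le_max_of_sum_bound => //.
- by rewrite mulr_ge0 ?subr_ge0 // ltW.
- by rewrite mulr_ge0 ?divr_ge0 ?subr_ge0 // ltW.
- apply: le_trans budget _.
  rewrite mulrDr lerD2l mulrA [in leRHS]mulrA -[leRHS]mulrA ler_pM2l //.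
  by rewrite mulrC sum_powRN_lt1 // theta_gt0.
Qed.
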